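(* Let $>$ be a ground-total reduction order and let $\Gamma\colon(\mathcal{E}_0,\mathcal{R}_0)\vdash_{\mathsf o}(\mathcal{E}_1,\mathcal{R}_1)\vdash_{\mathsf o}(\mathcal{E}_2,\mathcal{R}_2)\vdash_{\mathsf o}\cdots$ be an infinite run of ordered completion $\mathsf{KB_o}$ with respect to $>$, with $\mathcal{R}_0=\varnothing$. If $\Gamma$ is fair then $\mathcal{S}_\omega=\mathcal{E}_\omega^>\cup\mathcal{R}_\omega$ is ground-complete and the relations $\leftrightarrow_{\mathcal{E}_0}^*$ and $\leftrightarrow_{\mathcal{E}_\omega\cup\mathcal{R}_\omega}^*$ coincide.
   Context: Terms are built from a signature $\mathcal{F}$ and an infinite set of variables. An ES is a set of pairs of terms $s\approx t$; a TRS is a set of pairs $\ell\to r$ with $\ell$ not a variable and every variable of $r$ occurring in $\ell$. For a set $X$ of pairs of terms, $X^{\pm}=X\cup X^{-1}$, $\to_X$ is the closure of $X$ under contexts and substitutions, $\leftrightarrow_X$ its symmetric closure, $\leftrightarrow_X^*$ the conversion relation, and $\downarrow_X\,=\,\to_X^*\cdot{}_X^*{\leftarrow}$ joinability. A reduction order is a well-founded strict order on terms closed under contexts and substitutions; it is ground-total if any two distinct ground terms are comparable. A TRS $\mathcal{R}$ is ground-complete if it is terminating and, for all ground terms $s,t$, $s\,{}_{\mathcal{R}}^*{\leftarrow}\cdot\to_{\mathcal{R}}^*t$ implies $s\downarrow_{\mathcal{R}}t$. For an ES $\mathcal{E}$, $\mathcal{E}^>$ is the set of rules $\ell\sigma\to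 r\sigma$ with $\ell\approx r\in\mathcal{E}^\pm$, $\sigma$ a substitution, and $\ell\sigma>r\sigma$. A term $s$ encompasses $t$ if $s=C[t\sigma]$ for some $C,\sigma$; properly, if moreover $t$ does not encompass $s$. Write $t\to^{\rhd}_{\mathcal{R}}u$ if $t\to u$ using a rule $\ell\to r\in\mathcal{R}$ with $t$ properly encompassing $\ell$, and $t\to^{\rhd}_{\mathcal{E}^>}u$ if there are $\ell\approx r\in\mathcal{E}^\pm$, $C$, $\sigma$ with $t=C[\ell\sigma]$, $u=C[r\sigma]$, $\ell\sigma>r\sigma$, and $t$ properly encompasses $\ell$. Inference system $\mathsf{KB_o}$ ($\uplus$ is disjoint union): $(\mathcal{E},\mathcal{R})\vdash_{\mathsf o}(\mathcal{E}',\mathcal{R}')$ if it is an instance of one of - deduce: $(\mathcal{E},\mathcal{R})\vdash(\mathcal{E}\cup\{s\approx t\},\mathcal{R})$ if $s\,{}_{\mathcal{R}\cup\mathcal{E}^\pm}{\leftarrow}\cdot\to_{\mathcal{R}\cup\mathcal{E}^\pm}t$; - orient: $(\mathcal{E}\uplus\{s\approx t\},\mathcal{R})\vdash(\mathcal{E},\mathcal{R}\cup\{s\to t\})$ if $s>t$, and $(\mathcal{E}\uplus\{s\approx t\},\mathcal{R})\vdash(\mathcal{E},\mathcal{R}\cup\{t\to s\})$ if $t>s$; - delete: $(\mathcal{E}\uplus\{s\approx s\},\mathcal{R})\vdash(\mathcal{E},\mathcal{R})$; - compose: $(\mathcal{E},\mathcal{R}\uplus\{s\to t\})\vdash(\mathcal{E},\mathcal{R}\cup\{s\to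 u\})$ if $t\to_{\mathcal{E}^>\cup\mathcal{R}}u$; - simplify: $(\mathcal{E}\uplus\{s\approx t\},\mathcal{R})\vdash(\mathcal{E}\cup\{u\approx t\},\mathcal{R})$ if $s\to_{\mathcal{R}}u$ or $s\to^{\rhd}_{\mathcal{E}^>}u$, and $(\mathcal{E}\uplus\{s\approx t\},\mathcal{R})\vdash(\mathcal{E}\cup\{s\approx u\},\mathcal{R})$ if $t\to_{\mathcal{R}}u$ or $t\to^{\rhd}_{\mathcal{E}^>}u$; - collapse: $(\mathcal{E},\mathcal{R}\uplus\{t\to s\})\vdash(\mathcal{E}\cup\{u\approx s\},\mathcal{R})$ if $t\to^{\rhd}_{\mathcal{R}}u$ or $t\to^{\rhd}_{\mathcal{E}^>}u$. For an infinite run put $\mathcal{E}_\infty=\bigcup_{i}\mathcal{E}_i$, $\mathcal{E}_\omega=\bigcup_{i}\bigcap_{j\ge i}\mathcal{E}_j$, $\mathcal{R}_\omega=\bigcup_{i}\bigcap_{j\ge i}\mathcal{R}_j$. Extended prime critical pairs: an extended overlap of an ES $\mathcal{E}$ is a triple $\langle\ell_1\approx r_1,p,\ell_2\approx r_2\rangle$ where both equations are variants (up to renaming) of equations in $\mathcal{E}^\pm$ without common variables, $p$ is a non-variable position of $\ell_2$, $\ell_1$ and $\ell_2|_p$ are unifiable with mgu $\mu$, $r_1\mu\not>\ell_1\mu$ and $r_2\mu\not>\ell_2\mu$. It gives the extended critical pair $\ell_2[r_1]_p\mu\approx r_2\mu$, which is prime if all proper subterms of $\ell_1\mu$ are $\mathcal{E}^>$-normal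 forms. $\mathrm{PCP}_>(\mathcal{E})$ is the set of extended prime critical pairs of $\mathcal{E}$ (rules of $\mathcal{R}_\omega$ are viewed as equations in $\mathcal{E}_\omega\cup\mathcal{R}_\omega$). The run is fair if $\mathrm{PCP}_>(\mathcal{E}_\omega\cup\mathcal{R}_\omega)\subseteq{\downarrow_{\mathcal{S}_\omega}}\cup{\leftrightarrow_{\mathcal{E}_\infty}}$. *)

(* Defs.v *)
From Stdlib Require Import Relations.
From mathcomp Require Import all_boot.
From mathcomp Require Import boolp classical_sets cardinality.

Set Implicit Arguments.
Unset Strict Implicit.
Unset Printing Implicit Defensive.

Local Open Scope classical_set_scope.

Record signature := Signature { fsym :> Type; arity : fsym -> nat }.

Inductive term (F : signature) (V : Type) : Type :=
| Var of V
| App (f : F) of {ffun 'I_(arity f) -> term F V}.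

Arguments Var {F V} x.
Arguments App {F V} f ts.

Inductive ctx (F : signature) (V : Type) : Type :=
| Hole
(* the component [i] of the argument vector is ignored: the hole is there *)
| CApp (f : F) (i : 'I_(arity f)) of {ffun 'I_(arity f) -> term F V} & ctx F V.

Arguments Hole {F V}.
Arguments CApp {F V} f i ts C.

Section Terms.
Variables (F : signature) (V : Type).
Local Notation term := (term F V).
Local Notation ctx := (ctx F V).
Implicit Types (s t u : term) (C : ctx) (sigma tau : V -> term).

Fixpoint vars t : set V :=
  match t with
  | Var x => [set x]
  | App f ts => \bigcup_i vars (ts i)
  end.

Definition ground t : Prop := vars t = set0.

Definition is_var t : Prop := exists x, t = Var x.

Fixpoint subst sigma t : term :=
  match t with
  | Var x => sigma x
  | App f ts => App f [ffun i => subst sigma (ts i)]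
  end.

Fixpoint fill C t : term :=
  match C with
  | Hole => t
  | CApp f i ts C' => App f [ffun j => if j == i then fill C' t else ts j]
  end.

Definition proper_subterm u t : Prop := exists2 C, C <> Hole & t = fill C u.

(* Positions are sequences of argument indices, counted from 0;
   [subterm_at t p] is [None] when [p] is not a position of [t]. *)
Fixpoint subterm_at t (p : seq nat) : option term :=
  match p, t with
  | [::], _ => Some t
  | k :: q, App f ts =>
      if insub k is Some i then subterm_at (ts i) q else None
  | _ :: _, Var _ => None
  end.

(* [replace_at t p u] is t[u]_p when [p] is a position of [t]. *)
Fixpoint replace_at t (p : seq nat) u : term :=
  match p, t with
  | [::], _ => u
  | k :: q, App f ts =>
      App f [ffun i : 'I__ => if i == k :> nat then replace_at (ts i) q u
                              else ts i]
  | _ :: _, Var _ => t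
  end.

Definition encompasses s t : Prop :=
  exists C sigma, s = fill C (subst sigma t).

Definition properly_encompasses s t : Prop :=
  encompasses s t /\ ~ encompasses t s.

(* Both ESs and TRSs are sets of ordered pairs of terms; the additional
   conditions on the rules of a TRS are given by [is_trs]. *)
Definition es := set (term * term).

Definition is_trs (R : es) : Prop :=
  forall l r, R (l, r) -> ~ is_var l /\ vars r `<=` vars l.

Definition sym (X : es) : es := X `|` (X^-1)%relation.

Definition rstep (X : es) s t : Prop :=
  exists C sigma l r,
    [/\ X (l, r), s = fill C (subst sigma l) & t = fill C (subst sigma r)].

Definition rsteps (X : es) : relation term :=
  clos_refl_trans term (rstep X).

Definition srstep (X : es) s t : Prop := rstep X s t \/ rstep X t s.

Definition conv (X : es) : relation term :=
  clos_refl_trans term (srstep X).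

Definition joinable (X : es) s t : Prop :=
  exists u, rsteps X s u /\ rsteps X t u.

Definition normal_form (X : es) t : Prop := ~ exists u, rstep X t u.

Definition terminating (X : es) : Prop :=
  well_founded (fun u t => rstep X t u).

Definition ground_complete (R : es) : Prop :=
  [/\ is_trs R,
      terminating R &
      forall s t, ground s -> ground t ->
        (exists u, rsteps R u s /\ rsteps R u t) -> joinable R s t].

Record reduction_order (gt : relation term) : Prop := ReductionOrder {
  gt_irrefl : forall s, ~ gt s s;
  gt_trans : forall s t u, gt s t -> gt t u -> gt s u;
  gt_wf : well_founded (fun t s => gt s t);
  gt_ctx : forall C s t, gt s t -> gt (fill C s) (fill C t);
  gt_subst : forall sigma s t, gt s t -> gt (subst sigma s) (subst sigma t)
}.

Definition ground_total (gt : relation term) : Prop :=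
  forall s t, ground s -> ground t -> s <> t -> gt s t \/ gt t s.

Definition rstep_enc (R : es) t u : Prop :=
  exists C sigma l r,
    [/\ R (l, r), t = fill C (subst sigma l), u = fill C (subst sigma r) &
        properly_encompasses t l].

Definition renaming (pi : V -> V) : Prop := bijective pi.

Definition variant (e e' : term * term) : Prop :=
  exists2 pi, renaming pi &
    e' = (subst (fun x => Var (pi x)) e.1, subst (fun x => Var (pi x)) e.2).

Definition is_mgu (mu : V -> term) s t : Prop :=
  subst mu s = subst mu t /\
  forall tau, subst tau s = subst tau t ->
    exists delta, forall x, tau x = subst delta (mu x).

Section Order.
Variable gt : relation term.

Definition ordered_rules (E : es) : es :=
  [set e | exists l r sigma,
     [/\ sym E (l, r), gt (subst sigma l) (subst sigma r) &
         e = (subst sigma l, subst sigma r)]].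

(* Encompassment is tested against the uninstantiated side [l], so this is
   not [rstep_enc (ordered_rules E)]. *)
Definition ordered_step_enc (E : es) t u : Prop :=
  exists C sigma l r,
    sym E (l, r) /\
    [/\ t = fill C (subst sigma l), u = fill C (subst sigma r),
        gt (subst sigma l) (subst sigma r) &
        properly_encompasses t l].

(* A disjoint union of X with a singleton {e} is rendered as X `|` [set e]
   with the side condition ~ X e. *)
Inductive kbo : es * es -> es * es -> Prop :=
| kbo_deduce (E R : es) s t u :
    rstep (R `|` sym E) u s -> rstep (R `|` sym E) u t ->
    kbo (E, R) (E `|` [set (s, t)], R)
| kbo_orient_l (E R : es) s t :
    ~ E (s, t) -> gt s t ->
    kbo (E `|` [set (s, t)], R) (E, R `|` [set (s, t)])
| kbo_orient_r (E R : es) s t :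
    ~ E (s, t) -> gt t s ->
    kbo (E `|` [set (s, t)], R) (E, R `|` [set (t, s)])
| kbo_delete (E R : es) s :
    ~ E (s, s) ->
    kbo (E `|` [set (s, s)], R) (E, R)
| kbo_compose (E R : es) s t u :
    ~ R (s, t) -> rstep (ordered_rules E `|` R) t u ->
    kbo (E, R `|` [set (s, t)]) (E, R `|` [set (s, u)])
| kbo_simplify_l (E R : es) s t u :
    ~ E (s, t) -> rstep R s u \/ ordered_step_enc E s u ->
    kbo (E `|` [set (s, t)], R) (E `|` [set (u, t)], R)
| kbo_simplify_r (E R : es) s t u :
    ~ E (s, t) -> rstep R t u \/ ordered_step_enc E t u ->
    kbo (E `|` [set (s, t)], R) (E `|` [set (s, u)], R)
| kbo_collapse (E R : es) s t u :
    ~ R (t, s) -> rstep_enc R t u \/ ordered_step_enc E t u ->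
    kbo (E, R `|` [set (t, s)]) (E `|` [set (u, s)], R).

Definition ext_overlap (E : es) (e1 : term * term) (p : seq nat)
    (e2 : term * term) (mu : V -> term) : Prop :=
  (exists2 e, sym E e & variant e e1) /\
  (exists2 e, sym E e & variant e e2) /\
  (vars e1.1 `|` vars e1.2) `&` (vars e2.1 `|` vars e2.2) = set0 /\
  (exists v, [/\ subterm_at e2.1 p = Some v, ~ is_var v & is_mgu mu e1.1 v]) /\
  ~ gt (subst mu e1.2) (subst mu e1.1) /\
  ~ gt (subst mu e2.2) (subst mu e2.1).

Definition PCP (E : es) : es :=
  [set e | exists e1 p e2 mu,
     [/\ ext_overlap E e1 p e2 mu,
         forall v, proper_subterm v (subst mu e1.1) ->
           normal_form (ordered_rules E) v &
         e = (subst mu (replace_at e2.1 p e1.2), subst mu e2.2)]].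

End Order.

Definition union_of (X : nat -> es) : es := \bigcup_i X i.

Definition persistent (X : nat -> es) : es :=
  \bigcup_i \bigcap_(j in [set j | (i <= j)%N]) X j.

Definition kbo_run (gt : relation term) (E R : nat -> es) : Prop :=
  forall i, kbo gt (E i, R i) (E i.+1, R i.+1).

Definition S_omega (gt : relation term) (E R : nat -> es) : es :=
  ordered_rules gt (persistent E) `|` persistent R.

Definition fair (gt : relation term) (E R : nat -> es) : Prop :=
  forall s t, PCP gt (persistent E `|` persistent R) (s, t) ->
    joinable (S_omega gt E R) s t \/ srstep (union_of E) s t.

End Terms.

(* Main.v *)
(**
  Put W = E_omega U R_omega.  An equation or rule that is not persistent is
  eventually removed, and the inference that removes it replaces it by a smaller
  equation or rule together with a step that uses only smaller ones.
  Well-founded induction on the union of [gt] and proper encompassment thus shows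
  that every pair that ever occurs is W-convertible through terms that are not
  larger than its two sides.  In particular the critical pairs that fairness only
  locates in E_infty are W-connected below the source of their peak.

  On ground terms a W-step is an S_omega-step, the inverse of one, or trivial.  A
  ground peak at a redex whose proper subterms are irreducible is a variable
  overlap or an instance of a prime critical pair, hence is connected below its
  source; any other nested peak splits into two such peaks through an innermost
  redex inside the inner one.  Newman's lemma then gives ground confluence.
*)
Require Import Defs.
From Stdlib Require Import Relations.
From mathcomp Require Import all_boot.
From mathcomp Require Import boolp classical_sets cardinality.

Set Implicit Arguments.
Unset Strict Implicit.
Unset Printing Implicit Defensive.

Local Open Scope classical_set_scope.

(** * Reflexive-transitive closures *)

Lemma crt_bind (A B : Type) (R : relation A) (R' : relation B) (f : A -> B) :
  (forall x y, R x y -> clos_refl_trans B R' (f x) (f y)) ->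
  forall x y, clos_refl_trans A R x y -> clos_refl_trans B R' (f x) (f y).
Proof.
move=> H x y; elim=> [a b /H // | a | a b c _ IH1 _ IH2]; first exact: rt_refl.
exact: rt_trans IH1 IH2.
Qed.

Lemma crt_sym (A : Type) (R : relation A) :
  (forall x y, R x y -> R y x) ->
  forall x y, clos_refl_trans A R x y -> clos_refl_trans A R y x.
Proof.
move=> H x y; elim=> [a b /H | a | a b c _ IH1 _ IH2]; first exact: rt_step.
  exact: rt_refl.
exact: rt_trans IH2 IH1.
Qed.

(** * Terms and encompassment *)

Section Terms.
Variables (F : signature) (V : Type).
Local Notation term := (term F V).
Local Notation ctx := (ctx F V).
Implicit Types (s t u : term) (C D : ctx) (sigma tau : V -> term) (X : es F V).

(* The generated [term_ind] has no hypothesis on the arguments in the vector. *)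
Fixpoint term_nested_ind (P : term -> Prop) (HV : forall x, P (Var x))
    (HA : forall f (ts : {ffun 'I_(arity f) -> term}), (forall i, P (ts i)) -> P (App f ts)) t : P t :=
  match t with
  | Var x => HV x
  | App f ts => HA f ts (fun i => term_nested_ind HV HA (ts i))
  end.

Lemma subterm_at_nil t : subterm_at t [::] = Some t.
Proof. by case: t. Qed.

(** The type of the vector depends on [f], so injectivity of the constructor gives only a dependent
    equality; reading off each argument with [subterm_at] avoids it. *)
Lemma App_inj f (ts us : {ffun 'I_(arity f) -> term}) :
  App f ts = App f us -> ts = us.
Proof.
move=> e; apply/ffunP => i.
have : subterm_at (App f ts) [:: val i] = subterm_at (App f us) [:: val i].
  by rewrite e.
by rewrite /= valK !subterm_at_nil => -[].
Qed.

Fixpoint comp_ctx C D : ctx :=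
  match C with
  | Hole => D
  | CApp f i ts C' => CApp f i ts (comp_ctx C' D)
  end.

Fixpoint subst_ctx sigma C : ctx :=
  match C with
  | Hole => Hole
  | CApp f i ts C' => CApp f i [ffun j => subst sigma (ts j)] (subst_ctx sigma C')
  end.

Lemma fill_comp C D t : fill (comp_ctx C D) t = fill C (fill D t).
Proof. by elim: C => //= f i ts C ->. Qed.

Lemma subst_fill sigma C t :
  subst sigma (fill C t) = fill (subst_ctx sigma C) (subst sigma t).
Proof.
elim: C => //= f i ts C IH; congr App; apply/ffunP => j; rewrite !ffunE.
by case: eqP.
Qed.

Lemma subst_comp sigma tau t :
  subst sigma (subst tau t) = subst (fun x => subst sigma (tau x)) t.
Proof.
elim/term_nested_ind: t => //= f ts IH; congr App; apply/ffunP => i.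
by rewrite !ffunE IH.
Qed.

Lemma eq_in_subst sigma tau t :
  (forall x, vars t x -> sigma x = tau x) -> subst sigma t = subst tau t.
Proof.
elim/term_nested_ind: t => [x|f ts IH] /= H; first exact: H.
congr App; apply/ffunP => i; rewrite !ffunE; apply: IH => x xi.
by apply: H; exists i.
Qed.

Lemma subst_Var t : subst Var t = t.
Proof.
elim/term_nested_ind: t => //= f ts IH; congr App; apply/ffunP => i.
by rewrite !ffunE IH.
Qed.

Lemma vars_subst sigma t x :
  vars (subst sigma t) x <-> exists2 y, vars t y & vars (sigma y) x.
Proof.
elim/term_nested_ind: t => [z|f ts IH] /=.
  by split=> [H|[y ->]] //; exists z.
split=> [[i _]|[y [i _ yi] xy]].
  by rewrite ffunE => /IH[y yi xy]; exists y => //; exists i.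
by exists i => //; rewrite ffunE; apply/IH; exists y.
Qed.

Lemma vars_fill C t x : vars t x -> vars (fill C t) x.
Proof.
move=> xt; elim: C => //= f i ts C IH; exists i => //.
by rewrite ffunE eqxx.
Qed.

Lemma vars_ctx t x : vars t x -> exists C, t = fill C (Var x).
Proof.
elim/term_nested_ind: t => [z|f ts IH] /=; first by move->; exists Hole.
case=> i _ /IH[C e]; exists (CApp f i ts C); rewrite /= -e; congr App.
by apply/ffunP => j; rewrite ffunE; case: eqP => [->|].
Qed.

Lemma ground_fill C t : ground (fill C t) -> ground t.
Proof.
rewrite /ground -!subset0 => H x xt; exact: (H x (vars_fill C xt)).
Qed.

Lemma ground_subst sigma tau t :
  ground t -> subst sigma t = subst tau t.
Proof. by move=> gt; apply: eq_in_subst => x; rewrite gt. Qed.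

Lemma ground_subst_id sigma t : ground t -> subst sigma t = t.
Proof. by move=> /(ground_subst sigma Var) ->; rewrite subst_Var. Qed.

Lemma ground_substP sigma t :
  (forall x, vars t x -> ground (sigma x)) -> ground (subst sigma t).
Proof.
move=> H; rewrite /ground -subset0 => x /vars_subst[y /H].
by rewrite /ground -subset0 => /[apply].
Qed.

(** * Term size *)

Fixpoint tsize t : nat :=
  match t with
  | Var x => 1
  (* [.+2], so that also constants are larger than variables *)
  | App f ts => (sumn (codom (fun i => tsize (ts i)))).+2
  end.

Lemma tsize_App f (ts : {ffun 'I_(arity f) -> term}) :
  tsize (App f ts) = (\sum_i tsize (ts i)).+2.
Proof. by rewrite /= /codom sumnE /image_mem big_map big_enum. Qed.

Lemma tsize_gt0 t : 0 < tsize t.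
Proof. by case: t. Qed.

Lemma tsize_arg f (ts : {ffun 'I_(arity f) -> term}) i :
  tsize (ts i) < tsize (App f ts).
Proof. by rewrite tsize_App (bigD1 i) //= ltnS leqW // leq_addr. Qed.

(** The equality case serves to force a context to be trivial, both in the analysis of encompassment
    and in the occurs check. *)
Lemma tsize_fill C t : tsize t <= tsize (fill C t) ?= iff `[< C = Hole >].
Proof.
suff H : C = Hole \/ tsize t < tsize (fill C t).
  split; first by case: H => [->//|/ltnW].
  apply/eqP/asboolP => [e|-> //]; case: H => //; by rewrite e ltnn.
elim: C => [|f i ts C IH]; [by left|right].
rewrite [fill _ _]/=; set us := finfun _.
have := tsize_arg us i; rewrite {1}/us ffunE eqxx; apply: leq_trans.
by rewrite ltnS; case: IH => [->//|/ltnW].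
Qed.

Lemma tsize_proper u t : proper_subterm u t -> tsize u < tsize t.
Proof.
case=> C nh ->; have [le e] := tsize_fill C u.
rewrite ltn_neqAle le andbT e; exact/asboolP.
Qed.

Lemma tsize_subst sigma t : tsize t <= tsize (subst sigma t).
Proof.
elim/term_nested_ind: t => [x|f ts IH]; first exact: tsize_gt0.
rewrite [subst _ _]/= !tsize_App !ltnS leq_sum // => i _.
by rewrite ffunE.
Qed.

Lemma proper_subterm_subst sigma u t :
  proper_subterm u t -> proper_subterm (subst sigma u) (subst sigma t).
Proof.
move=> [C nC ->]; exists (subst_ctx sigma C); last exact: subst_fill.
by case: C nC.
Qed.

(** * Rewriting under contexts and substitutions *)

Lemma rstep_fill X C s t : rstep X s t -> rstep X (fill C s) (fill C t).
Proof.
move=> [D [sigma [l [r [Xlr -> ->]]]]].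
by exists (comp_ctx C D), sigma, l, r; rewrite !fill_comp.
Qed.

Lemma rstep_subst X sigma s t :
  rstep X s t -> rstep X (subst sigma s) (subst sigma t).
Proof.
move=> [D [tau [l [r [Xlr -> ->]]]]].
exists (subst_ctx sigma D), (fun x => subst sigma (tau x)), l, r.
by rewrite !subst_fill !subst_comp.
Qed.

Lemma rsteps_fill X C s t : rsteps X s t -> rsteps X (fill C s) (fill C t).
Proof. by apply: crt_bind => x y h; apply/rt_step/rstep_fill. Qed.

Lemma rsteps_subst X sigma s t :
  rsteps X s t -> rsteps X (subst sigma s) (subst sigma t).
Proof.
by apply: (crt_bind (f := subst sigma)) => x y h; apply/rt_step/rstep_subst.
Qed.

Lemma rsteps_App X f (ts us : {ffun 'I_(arity f) -> term}) :
  (forall i, rsteps X (ts i) (us i)) -> rsteps X (App f ts) (App f us).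
Proof.
(* In [w l] the arguments with index in [l] are already rewritten. Adding an index to [l] rewrites
   one further argument, or nothing if the index was there before. *)
move=> H; pose w (l : seq 'I_(arity f)) := [ffun i => if i \in l then us i else ts i].
suff K l : rsteps X (App f ts) (App f (w l)).
  have -> : us = w (enum 'I_(arity f)).
    by apply/ffunP => i; rewrite ffunE mem_enum.
  exact: K.
elim: l => [|i l IH].
  suff -> : w [::] = ts by apply: rt_refl.
  by apply/ffunP => i; rewrite ffunE.
apply: rt_trans IH _.
have e x : x = w l i \/ x = us i ->
    fill (CApp f i (w l) Hole) x = App f [ffun j => if j == i then x else w l j].
  by [].
have -> : App f (w l) = fill (CApp f i (w l) Hole) (w l i).
  by congr App; apply/ffunP => j; rewrite [RHS]ffunE; case: eqP => [->|].
have -> : App f (w (i :: l)) = fill (CApp f i (w l) Hole) (us i).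
  congr App; apply/ffunP => j; rewrite !ffunE inE; by case: eqP => [->|].
apply: rsteps_fill; rewrite ffunE; case: ifP => _; [exact: rt_refl|exact: H].
Qed.

Lemma rsteps_subst_fun X sigma tau t :
  (forall x, rsteps X (sigma x) (tau x)) -> rsteps X (subst sigma t) (subst tau t).
Proof.
move=> H; elim/term_nested_ind: t => [x|f ts IH] /=; first exact: H.
by apply: rsteps_App => i; rewrite !ffunE.
Qed.

(** * Well-foundedness of proper encompassment *)

Lemma encompasses_refl t : encompasses t t.
Proof. by exists Hole, Var; rewrite subst_Var. Qed.

Lemma encompasses_trans s t u :
  encompasses s t -> encompasses t u -> encompasses s u.
Proof.
move=> [C [sigma ->]] [D [tau ->]].
exists (comp_ctx C (subst_ctx sigma D)), (fun x => subst sigma (tau x)).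
by rewrite fill_comp subst_fill subst_comp.
Qed.

(** A list version of [vars] over the classical [eqType] on [V], so that distinct variables can be
    counted and avoided. *)
Fixpoint varseq t : seq {classic V} :=
  match t with
  | Var x => [:: x]
  | App f ts => flatten (codom (fun i => varseq (ts i)))
  end.

Lemma varseqP x t : reflect (vars t x) ((x : {classic V}) \in varseq t).
Proof.
apply: (iffP idP).
  elim/term_nested_ind: t => [z|f ts IH] /=; first by rewrite inE => /eqP.
  by move=> /flattenP[_ /codomP[i ->]] /IH; exists i.
elim/term_nested_ind: t => [z|f ts IH] /=; first by move=> ->; rewrite inE.
case=> i _ /IH h; apply/flattenP; exists (varseq (ts i)) => //.
exact: codom_f.
Qed.

Lemma size_varseq t : size (varseq t) <= tsize t.
Proof.
elim/term_nested_ind: t => [z|f ts IH] //.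
rewrite tsize_App /= size_flatten sumnE /shape /codom /image_mem 2!big_map big_enum /=.
by do 2!apply: leqW; apply: leq_sum.
Qed.

Lemma varseq_subst_Var (f : V -> V) t :
  varseq (subst (fun x => Var (f x)) t) = map (f : {classic V} -> {classic V}) (varseq t).
Proof.
elim/term_nested_ind: t => //= g ts IH.
rewrite map_flatten; congr flatten; rewrite /codom /image_mem -map_comp.
by apply: eq_map => i /=; rewrite ffunE IH.
Qed.

Definition nvars t := size (undup (varseq t)).

Lemma nvars_le_tsize t : nvars t <= tsize t.
Proof. exact: leq_trans (size_undup _) (size_varseq _). Qed.

Lemma tsize_Var t : tsize t <= 1 -> exists y, t = Var y.
Proof. by case: t => [y _|f ts]; [exists y|rewrite tsize_App]. Qed.

(** Variables are the only terms of size 1, so a non-variable image of an occurring variable would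
    increase the size. *)
Lemma tsize_subst_eq sigma t : tsize (subst sigma t) <= tsize t ->
  forall x, vars t x -> exists y, sigma x = Var y.
Proof.
elim/term_nested_ind: t => [z /tsize_Var e x -> //|f ts IH e x [i _]].
apply: IH; move: e; rewrite [subst _ _]/= !tsize_App !ltnS (bigD1 i) //=.
rewrite [leqRHS](bigD1 i) //= ffunE => e.
rewrite -(leq_add2r (\sum_(j | j != i) tsize (ts j))); apply: leq_trans e.
by rewrite leq_add2l leq_sum // => j _; rewrite ffunE tsize_subst.
Qed.

(** A map that does not lower the number of distinct variables of [t] is injective on them, hence
    has a left inverse there. *)
Lemma renamed_variables (f : V -> V) t :
  nvars t <= nvars (subst (fun x => Var (f x)) t) ->
  exists g, subst (fun x => Var (g x)) (subst (fun x => Var (f x)) t) = t.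
Proof.
rewrite /nvars varseq_subst_Var; set L := varseq t => le.
pose f' : {classic V} -> {classic V} := f.
have uf : uniq (map f' (undup L)).
  apply: leq_size_uniq (undup_uniq (map f' L)) _ _; last by rewrite size_map.
  by move=> y; rewrite mem_undup => /mapP[x xL ->]; rewrite map_f // mem_undup.
have inj x y : x \in L -> y \in L -> f' x = f' y -> x = y.
  rewrite -!(mem_undup L) => xL yL e.
  rewrite -(nth_index x xL) -(nth_index x yL); congr nth.
  apply/eqP; rewrite -(nth_uniq (f' x) _ _ uf) ?size_map ?index_mem //.
  by rewrite !(nth_map x) ?index_mem // !nth_index // e.
have /choice[g gP] : forall y, exists x, forall x0, vars t x0 -> f x0 = y -> x = x0.
  move=> y; have [[x [xt e]]|n] := pselect (exists x, vars t x /\ f x = y).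
    exists x => x0 x0t e0; apply: inj; [exact/varseqP..|by rewrite /f' e e0].
  by exists y => x0 x0t e0; case: n; exists x0.
exists g; rewrite subst_comp -[RHS]subst_Var; apply: eq_in_subst => x xt /=.
by rewrite (gP _ x).
Qed.

(* If the sizes agree, the matching substitution maps variables to variables,
   and it is not invertible only when it identifies two of them. *)
Lemma properly_encompasses_lt s t : properly_encompasses s t ->
  tsize t < tsize s \/ tsize s = tsize t /\ nvars s < nvars t.
Proof.
move=> [[C [sigma e]] ne].
have l1 := tsize_subst sigma t; have [l2 l3] := tsize_fill C (subst sigma t).
have [l4|l4] := ltnP (tsize t) (tsize s); [by left|right].
have e1 : tsize (subst sigma t) = tsize t.
  by apply/eqP; rewrite eqn_leq l1 (leq_trans l2) // -e.
have e2 : tsize s = tsize t.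
  by apply/eqP; rewrite eqn_leq l4 /= (leq_trans l1) // e.
have C0 : C = Hole by apply/asboolP; rewrite -l3 -e e1 e2.
split=> //; rewrite ltnNge; apply/negP => le.
have /choice[f fP] : forall x, exists y, vars t x -> sigma x = Var y.
  move=> x; have [xt|] := pselect (vars t x); last by exists x.
  by have [|y] := @tsize_subst_eq sigma t _ x xt; [rewrite e1|exists y].
have e3 : s = subst (fun x => Var (f x)) t.
  by rewrite e C0 /=; apply: eq_in_subst => x /fP.
case: ne; rewrite e3 in le *; have [g ge] := renamed_variables le.
by exists Hole, (fun x => Var (g x)); rewrite /= ge.
Qed.

Lemma properly_encompasses_ind (P : term -> Prop) :
  (forall s, (forall t, properly_encompasses s t -> P t) -> P s) ->
  forall s, P s.
Proof.
move=> H.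
(* Lexicographic descent: at equal size [nvars] grows, but it is bounded by [tsize], so the
   difference decreases. *)
suff K n m s : tsize s < n -> tsize s - nvars s < m -> P s.
  by move=> s; apply: (K (tsize s).+1 (tsize s - nvars s).+1).
elim: n m s => [//|n IHn]; elim=> [//|m IHm] s sn sm.
apply: H => t /properly_encompasses_lt[lt|[e lt]].
  by apply: (IHn (tsize t - nvars t).+1) => //; apply: leq_trans lt _.
apply: IHm; first by rewrite -e.
rewrite -e; rewrite ltnS in sm; apply: leq_trans sm; apply: ltn_sub2l => //.
by rewrite e; apply: leq_trans lt (nvars_le_tsize t).
Qed.

End Terms.

(** * Unification, renaming and overlaps *)

Section Unification.
Variables (F : signature) (V : Type).
Local Notation term := (term F V).
Local Notation ctx := (ctx F V).
Implicit Types (s t u : term) (C D : ctx) (sigma tau : V -> term) (X : es F V).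

Definition update (T : Type) (f : V -> T) (x : V) (t : T) : V -> T :=
  fun y => if `[< y = x >] then t else f y.

Lemma update_eq (T : Type) (f : V -> T) x (t : T) : update f x t x = t.
Proof. by rewrite /update asboolT. Qed.

Lemma update_neq (T : Type) (f : V -> T) x (t : T) y : y <> x -> update f x t y = f y.
Proof. by move=> h; rewrite /update asboolF. Qed.

Fixpoint unifies sigma (l : seq (term * term)) : Prop :=
  match l with
  | [::] => True
  | e :: l' => subst sigma e.1 = subst sigma e.2 /\ unifies sigma l'
  end.

Definition most_general sigma (l : seq (term * term)) : Prop :=
  forall tau, unifies tau l -> exists delta, forall x, tau x = subst delta (sigma x).

Lemma unifies_cat sigma l1 l2 :
  unifies sigma (l1 ++ l2) <-> unifies sigma l1 /\ unifies sigma l2.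
Proof.
by elim: l1 => [|e l1 IH] /=; [tauto|rewrite IH; tauto].
Qed.

Lemma unifies_map (I : eqType) sigma (ts us : I -> term) (l : seq I) :
  unifies sigma [seq (ts i, us i) | i <- l] <->
  (forall i, i \in l -> subst sigma (ts i) = subst sigma (us i)).
Proof.
elim: l => //= a l ->; split=> [[h1 h2] i|h].
  by rewrite inE => /predU1P[->//|/h2].
split=> [|i il]; apply: h; first exact: mem_head.
by rewrite inE il orbT.
Qed.

Lemma unifies_App sigma f (ts us : {ffun 'I_(arity f) -> term}) :
  subst sigma (App f ts) = subst sigma (App f us) <->
  unifies sigma [seq (ts i, us i) | i <- enum 'I_(arity f)].
Proof.
rewrite unifies_map; split=> [/App_inj/ffunP e i _|e].
  by have := e i; rewrite !ffunE.
by congr App; apply/ffunP => i; rewrite !ffunE; apply: e; rewrite mem_enum.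
Qed.

(** A unifier of [x] and [t] absorbs the elimination of [x] by [t]. *)
Lemma subst_update_Var tau x t s :
  tau x = subst tau t -> subst tau (subst (update Var x t) s) = subst tau s.
Proof.
move=> e; rewrite subst_comp; apply: eq_in_subst => y _.
have [->|ne] := pselect (y = x); first by rewrite update_eq.
by rewrite update_neq.
Qed.

Lemma unifies_subst sigma tau l :
  unifies tau [seq (subst sigma e.1, subst sigma e.2) | e <- l] <->
  unifies (fun y => subst tau (sigma y)) l.
Proof. by elim: l => //= e l ->; rewrite !subst_comp. Qed.

Lemma eq_unifies sigma tau l : sigma =1 tau -> unifies sigma l -> unifies tau l.
Proof. by move=> e; have -> : sigma = tau by exact/funext. Qed.

(** If [x] occurred properly in [t], then [tau x] would be a proper subterm of itself. *)
Lemma occurs_check tau x t :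
  tau x = subst tau t -> vars t x -> t = Var x.
Proof.
move=> tE xt; have [C e] := vars_ctx xt; move: tE; rewrite e subst_fill /= => tE.
have [_] := tsize_fill (subst_ctx tau C) (tau x).
rewrite -tE eqxx => /esym/asboolP.
by case: C {e tE}.
Qed.

(** Left components suffice, since a unifier gives both components the same size. *)
Definition weight sigma (l : seq (term * term)) :=
  \sum_(e <- l) tsize (subst sigma e.1).

(** The two existence hypotheses come from the induction in [mgu_exists_seq]. The first settles the
    case that [x] occurs in [t], where the equation is trivial; otherwise the unifier of the second
    is composed with the elimination of [x]. *)
Lemma mgu_elim_var tau x t l :
  tau x = subst tau t ->
  (exists mu, unifies mu l /\ most_general mu l) ->
  (let l' := [seq (subst (update Var x t) e.1, subst (update Var x t) e.2) | e <- l] in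
   exists mu, unifies mu l' /\ most_general mu l') ->
  exists mu, [/\ unifies mu l, most_general mu ((Var x, t) :: l) & mu x = subst mu t].
Proof.
move=> e h1 [mu [u1 u2]].
have [xt|xt] := pselect (vars t x).
  have t0 := occurs_check e xt; have [nu [v1 v2]] := h1; exists nu; split=> //.
    by move=> tau' [_]; apply: v2.
  by rewrite t0.
have tE : subst (update Var x t) t = t.
  rewrite -[RHS]subst_Var; apply: eq_in_subst => y yt; rewrite update_neq //.
  by move=> yx; apply: xt; rewrite -yx.
exists (fun y => subst mu (update Var x t y)); split.
- exact/unifies_subst.
- move=> tau' [/= e' un]; have [|delta dE] := u2 tau'.
    apply/unifies_subst; apply: eq_unifies un => y.
    by rewrite -[LHS](subst_update_Var (Var y) e').
  exists delta => y; rewrite subst_comp.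
  by rewrite -(eq_in_subst (sigma := tau')) // (subst_update_Var (Var y) e').
- by rewrite update_eq -subst_comp tE.
Qed.

(* The measure is the total size of the equations under a known unifier:
   eliminating a variable does not change the instances of the remaining
   equations, so every step decreases it. *)
Lemma mgu_exists_seq tau l :
  unifies tau l -> exists mu, unifies mu l /\ most_general mu l.
Proof.
have [n] := ubnP (weight tau l); elim: n tau l => [//|n IH] tau [|[s t] l].
  by move=> _ _; exists Var; split=> // tau' _; exists tau'.
rewrite /weight big_cons /= ltnS => wn [e un].
have s0 : weight tau l < n.
  by apply: leq_trans wn; rewrite -[X in X < _]add0n ltn_add2r tsize_gt0.
have elimx x u : tau x = subst tau u ->
    exists mu, [/\ unifies mu l, most_general mu ((Var x, u) :: l) &
                   mu x = subst mu u].
  move=> eu; apply: (mgu_elim_var eu); first exact: IH un.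
  apply: (IH tau); last first.
    by apply/unifies_subst; apply: eq_unifies un => y;
       rewrite -[LHS](subst_update_Var (Var y) eu).
  by rewrite /weight big_map; under eq_bigr => i _ do rewrite subst_update_Var //.
case: s t e wn => [x|f ts] [y|g us] e wn.
- by have [mu [m1 m2 m3]] := elimx x (Var y) e; exists mu.
- by have [mu [m1 m2 m3]] := elimx x (App g us) e; exists mu.
- have [mu [m1 m2 m3]] := elimx y (App f ts) (esym e); exists mu; split=> //.
  by move=> tau' [/= e' u']; apply: m2; split.
- have fg : f = g by case: e.
  subst g; have e' := e; move/unifies_App: e => e.
  have [||mu [m1 m2]] :=
      IH tau ([seq (ts i, us i) | i <- enum 'I_(arity f)] ++ l).
  + rewrite /weight big_cat big_map big_enum /=.
    apply: leq_trans wn; rewrite ltn_add2r [subst _ _]/= tsize_App ltnS leqW //.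
    by apply: leq_sum => i _; rewrite ffunE.
  + exact/unifies_cat.
  exists mu; move/unifies_cat: m1 => [m0 m1]; split; first by split=> //; exact/unifies_App.
  by move=> tau' [/unifies_App h1 h2]; apply: m2; exact/unifies_cat.
Qed.

Lemma mgu_exists tau s t :
  subst tau s = subst tau t -> exists mu, is_mgu mu s t.
Proof.
move=> e; have [//|mu [[m1 _] m2]] := @mgu_exists_seq tau [:: (s, t)].
by exists mu; split=> // tau' e'; apply: m2.
Qed.

Definition swap (a b x : {classic V}) : {classic V} :=
  if x == a then b else if x == b then a else x.

Lemma swapK a b : involutive (swap a b).
Proof.
move=> x; rewrite /swap; have [->|xa] := eqVneq x a.
  by rewrite eqxx; case: eqVneq.
have [->|xb] := eqVneq x b; first by rewrite eqxx.
by rewrite (negbTE xa) (negbTE xb).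
Qed.

(** A renaming is a bijection on all of [V], so it is built from transpositions: an offending value
    [pi a] is swapped with some [z] that lies neither in [B] nor among the images of the remaining
    variables. *)
Lemma fresh_renaming (V_infinite : infinite_set [set: V]) (A B : seq {classic V}) :
  exists2 pi : {classic V} -> {classic V}, renaming (pi : V -> V) &
    forall x, x \in A -> pi x \notin B.
Proof.
elim: A => [|a A [pi [pi' K K'] piA]]; first by exists id => //; exists id.
have [pia|pia] := boolP (pi a \in B); last first.
  exists pi; first by exists pi'.
  by move=> x; rewrite inE => /predU1P[->|/piA].
have [z zB] : exists z : {classic V}, z \notin B ++ [seq pi x | x <- A].
  apply: contrapT => /forallNP nz; apply: V_infinite.
  apply: (@sub_finite_set _ _ [set` (B ++ [seq pi x | x <- A])]).
    by move=> x _ /=; apply/negPn/negP; exact: nz.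
  exact: finite_seq.
move: zB; rewrite mem_cat negb_or => /andP[zB zA].
exists (fun x => swap (pi a) z (pi x)).
  exists (fun x => pi' (swap (pi a) z x)) => x; first by rewrite swapK K.
  by rewrite K' swapK.
move=> x; rewrite inE => /predU1P[->|xA].
  by rewrite /swap eqxx.
rewrite /swap; case: eqP => [//|_]; case: eqP => [e|_]; last exact: piA.
by case/negP: zA; apply/mapP; exists x.
Qed.

(** The hole of [C] lies either at a non-variable position of [l] or inside the instance of a
    variable [x]. In the second case [fill C b] changes only one occurrence of [x]; rewriting the
    others as well gives an instance of [l] again. *)
Lemma overlap_cases sigma l C a : fill C a = subst sigma l ->
  (exists q v, [/\ subterm_at l q = Some v, ~ is_var v, a = subst sigma v &
     forall r, subst sigma (replace_at l q r) = fill C (subst sigma r)]) \/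
  (exists x C', sigma x = fill C' a /\ forall X b, rsteps X a b ->
     rsteps X (fill C b) (subst (update sigma x (fill C' b)) l)).
Proof.
elim/term_nested_ind: l C => [x C e|f ts IH [|g i us C] e].
- right; exists x, C; split=> // X b _ /=; rewrite update_eq; exact: rt_refl.
- left; exists [::], (App f ts); split=> //; by case.
have fg : g = f by move: e => /= [].
subst g; move/App_inj/ffunP: e => e.
have ei := e i; rewrite !ffunE eqxx in ei.
have {}e j : j <> i -> us j = subst sigma (ts j).
  by move=> ji; have := e j; rewrite !ffunE; case: eqP.
have [[q [v [h1 h2 h3 h4]]]|[x [C' [h1 h2]]]] := IH i C ei.
  left; exists (val i :: q), v; split=> //; first by rewrite /= valK.
  move=> r; congr App; apply/ffunP => j; rewrite !ffunE val_eqE.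
  by case: eqP => [->|/e].
right; exists x, C'; split=> // X b ab; apply: rsteps_App => j.
rewrite !ffunE; case: eqP => [->|/e ->]; first exact: h2.
apply: rsteps_subst_fun => y.
have [->|yx] := pselect (y = x); last by rewrite update_neq //; exact: rt_refl.
by rewrite update_eq h1; exact: rsteps_fill.
Qed.

(** The two holes are nested one way or the other, or parallel. In the parallel case [D1] is [C1]
    after replacing [b] by [b'], and [D2] is [C2] after replacing [a] by [a']. *)
Lemma fill_eq_cases C1 C2 a b : fill C1 a = fill C2 b ->
  [\/ exists C, b = fill C a /\ forall x, fill C1 x = fill C2 (fill C x),
      exists C, a = fill C b /\ forall x, fill C2 x = fill C1 (fill C x) |
      forall a' b', exists D1 D2,
        [/\ fill C1 a' = fill D2 b, fill C2 b' = fill D1 a &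
            fill D2 b' = fill D1 a']].
Proof.
elim: C1 C2 => [|f i ts C1 IH] [|g j us C2] e.
- by apply: Or31; exists Hole.
- by apply: Or32; exists (CApp g j us C2).
- by apply: Or31; exists (CApp f i ts C1).
have fg : f = g by move: e => /= [].
subst g; move/App_inj/ffunP: e => e.
have [ij|ij] := eqVneq i j.
  subst j; have ei := e i; rewrite !ffunE eqxx in ei.
  (* The vectors may differ at the ignored index [i], so the contexts agree only after filling. *)
  have {}e : forall k x, (if k == i then x else ts k) = (if k == i then x else us k).
    by move=> k x; have := e k; rewrite !ffunE; case: eqP.
  have E x : fill (CApp f i ts Hole) x = fill (CApp f i us Hole) x.
    by congr App; apply/ffunP => k; rewrite !ffunE e.
  have [[C [h1 h2]]|[C [h1 h2]]|h] := IH _ ei.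
  + apply: Or31; exists C; split=> // x; rewrite [LHS](E (fill C1 x)) /=.
    by rewrite h2.
  + apply: Or32; exists C; split=> // x; rewrite [RHS](E (fill C1 _)) /=.
    by rewrite h2.
  + apply: Or33 => a' b'; have [D1 [D2 [d1 d2 d3]]] := h a' b'.
    exists (CApp f i ts D1), (CApp f i us D2); split.
    * by rewrite [LHS](E (fill C1 a')) /= d1.
    * by rewrite [RHS](E (fill D1 a)) /= d2.
    * by rewrite [RHS](E (fill D1 a')) /= d3.
apply: Or33 => a' b'.
exists (CApp f i [ffun k => if k == j then fill C2 b' else us k] C1).
exists (CApp f j [ffun k => if k == i then fill C1 a' else ts k] C2).
have ji : (j == i) = false by rewrite eq_sym; exact/negbTE.
split; congr App; apply/ffunP => k; rewrite !ffunE; have := e k; rewrite !ffunE;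
  have [->|ki] := eqVneq k i; have [kj|kj] := eqVneq; subst => //;
  by rewrite ?eqxx in ij ji *.
Qed.

End Unification.

(** * Connectedness and the inference rules *)

Section Order.
Variables (F : signature) (V : Type).
Local Notation term := (term F V).
Local Notation ctx := (ctx F V).
Implicit Types (s t u l r : term) (C : ctx) (sigma tau : V -> term) (X Y : es F V).

Lemma srstep_sym X s t : srstep X s t -> srstep X t s.
Proof. by case; [right|left]. Qed.

Lemma srstep_fill X C s t : srstep X s t -> srstep X (fill C s) (fill C t).
Proof. by case=> h; [left|right]; apply: rstep_fill. Qed.

Lemma srstep_subst X sigma s t :
  srstep X s t -> srstep X (subst sigma s) (subst sigma t).
Proof. by case=> h; [left|right]; apply: rstep_subst. Qed.

Lemma rstep_pair X l r : X (l, r) -> rstep X l r.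
Proof. by exists Hole, Var, l, r; rewrite /= !subst_Var. Qed.

Lemma rstep_mono X Y s t : X `<=` Y -> rstep X s t -> rstep Y s t.
Proof. by move=> XY [C [sigma [l [r [/XY h -> ->]]]]]; exists C, sigma, l, r. Qed.

Lemma rstep_setU X Y s t : rstep (X `|` Y) s t -> rstep X s t \/ rstep Y s t.
Proof.
by move=> [C [sigma [l [r [[h|h] -> ->]]]]]; [left|right]; exists C, sigma, l, r.
Qed.

Lemma conv_sym X s t : conv X s t -> conv X t s.
Proof. by apply: crt_sym => x y; apply: srstep_sym. Qed.

Lemma conv_fill_subst X C sigma s t :
  conv X s t -> conv X (fill C (subst sigma s)) (fill C (subst sigma t)).
Proof.
apply: (crt_bind (f := fun x => fill C (subst sigma x))) => x y h.
exact/rt_step/srstep_fill/srstep_subst.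
Qed.

Lemma conv_of_pairs X Y :
  (forall l r, X (l, r) -> conv Y l r) -> forall s t, conv X s t -> conv Y s t.
Proof.
move=> H; have K x y : rstep X x y -> conv Y x y.
  by move=> [C [sigma [l [r [/H h -> ->]]]]]; exact: conv_fill_subst.
by apply: (crt_bind (f := id)) => x y [/K //|/K /conv_sym].
Qed.

Lemma sym_pair X l r : sym X (l, r) -> X (l, r) \/ X (r, l).
Proof. by case; [left|right]. Qed.

(** The bound [D] is put on the steps, so an empty conversion demands nothing of its term. *)
Definition conv_in (D : term -> Prop) X : relation term :=
  clos_refl_trans term (fun s t => [/\ D s, D t & srstep X s t]).

Lemma conv_in_sym D X s t : conv_in D X s t -> conv_in D X t s.
Proof. by apply: crt_sym => x y [? ? /srstep_sym]. Qed.

(** Steps may become trivial under [f], as happens when a conversion is made ground. *)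
Lemma conv_in_map (D D' : term -> Prop) X Y (f : term -> term) s t :
  (forall x, D x -> D' (f x)) ->
  (forall x y, D' (f x) -> D' (f y) -> srstep X x y ->
     srstep Y (f x) (f y) \/ f x = f y) ->
  conv_in D X s t -> conv_in D' Y (f s) (f t).
Proof.
move=> DD' XY; apply: crt_bind => x y [/DD' xD /DD' yD /(XY _ _ xD yD)[h|->]].
  exact: rt_step.
exact: rt_refl.
Qed.

Lemma conv_in_mono (D D' : term -> Prop) X s t :
  (forall x, D x -> D' x) -> conv_in D X s t -> conv_in D' X s t.
Proof. by move=> DD'; apply: (conv_in_map (f := id)) => // x y _ _; left. Qed.

Lemma conv_in_conv D X s t : conv_in D X s t -> conv X s t.
Proof. by apply: (crt_bind (f := id)) => x y [_ _]; apply: rt_step. Qed.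

Variable gt : relation term.
Hypothesis gt_red : reduction_order gt.

(** Otherwise iterating [C] gives an infinite descending chain from [s]. *)
Lemma not_gt_fill C s : ~ gt s (fill C s).
Proof.
elim/(well_founded_ind (gt_wf gt_red)): s => s IH h.
by apply: (IH _ h); apply: gt_ctx h.
Qed.

(** If [y] occurred only in [t], substituting [s] for [y] would fix [s] and turn [t] into a term
    containing [s]. *)
Lemma gt_vars s t : gt s t -> vars t `<=` vars s.
Proof.
move=> st y yt; apply: contrapT => ys; have [C e] := vars_ctx yt.
have := gt_subst gt_red (update Var y s) st.
rewrite e subst_fill /= update_eq.
have -> : subst (update Var y s) s = s.
  rewrite -[RHS]subst_Var; apply: eq_in_subst => x xs; rewrite update_neq //.
  by move=> xy; apply: ys; rewrite -xy.
exact: not_gt_fill.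
Qed.

(** If [x] occurs in [t], then [t] is a context around [x]; otherwise [t] is ground and substituting
    [t] for [x] yields [gt t t]. *)
Lemma gt_not_var s t : gt s t -> ~ is_var s.
Proof.
move=> st [x e]; rewrite e in st.
have [h|h] := pselect (vars t x).
  by have [C e'] := vars_ctx h; rewrite e' in st; exact: not_gt_fill st.
have := gt_subst gt_red (fun=> t) st; rewrite /= (_ : subst _ t = t); first exact: gt_irrefl.
by apply: ground_subst_id; rewrite /ground -subset0 => y yt; have := gt_vars st yt => /= e'; apply: h; rewrite -e'.
Qed.

Lemma gt_ground s t : gt s t -> ground s -> ground t.
Proof. by move=> /gt_vars h; rewrite /ground -!subset0; apply: subset_trans. Qed.

Lemma rstep_gt X s t : (forall l r, X (l, r) -> gt l r) -> rstep X s t -> gt s t.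
Proof.
by move=> H [C [sigma [l [r [/H h -> ->]]]]]; apply: gt_ctx => //; apply: gt_subst.
Qed.

Lemma rsteps_gt X s t : (forall l r, X (l, r) -> gt l r) -> rsteps X s t ->
  s = t \/ gt s t.
Proof.
move=> H; elim=> [x y /(rstep_gt H)|x|x y z _ [->|h] _ [<-|h']]; auto.
by right; apply: gt_trans h h'.
Qed.

Lemma ordered_rules_gt X l r : ordered_rules gt X (l, r) -> gt l r.
Proof. by move=> [l' [r' [sigma [_ h [-> ->]]]]]. Qed.

Lemma rstep_orderedP X s t :
  rstep (ordered_rules gt X) s t <->
  exists C sigma l r, [/\ sym X (l, r), gt (subst sigma l) (subst sigma r),
    s = fill C (subst sigma l) & t = fill C (subst sigma r)].
Proof.
split=> [[C [sigma [_ [_ [[l [r [tau [h g [-> ->]]]] -> ->]]]]]]|].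
  exists C, (fun x => subst sigma (tau x)), l, r.
  by rewrite -!subst_comp; split=> //; apply: gt_subst.
move=> [C [sigma [l [r [h g -> ->]]]]].
by exists C, Var, (subst sigma l), (subst sigma r); rewrite !subst_Var; split=> //; exists l, r, sigma.
Qed.

(* The union of [gt] and proper encompassment, made transitive: it is well-founded
   because encompassment followed by [gt] is contained in [gt] followed by
   encompassment. *)
Definition above s l : Prop :=
  (exists2 t, gt s t & encompasses t l) \/ properly_encompasses s l.

Lemma encompasses_above s t u : encompasses s t -> above t u -> above s u.
Proof.
move=> st [[v tv vu]|[tu ut]]; last first.
  by right; split; [exact: encompasses_trans st tu|move=> /encompasses_trans/(_ st)].
left; case: st => C [sigma ->]; exists (fill C (subst sigma v)).
  by apply: gt_ctx => //; apply: gt_subst.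
by apply: encompasses_trans vu; exists C, sigma.
Qed.

Lemma above_encompasses s t u : above s t -> encompasses t u -> above s u.
Proof.
move=> [[v sv vt]|[st ts]] tu; [left|right].
  by exists v => //; exact: encompasses_trans vt tu.
by split; [exact: encompasses_trans st tu|move=> /(encompasses_trans tu)].
Qed.

Lemma gt_above s t : gt s t -> above s t.
Proof. by move=> st; left; exists t => //; exact: encompasses_refl. Qed.

Lemma above_gt s t u : above s t -> gt t u -> above s u.
Proof.
move=> [[v sv vt]|[st _]] /gt_above h; last exact: encompasses_above h.
left; case: (encompasses_above vt h) => [[w vw wu]|[vu _]].
  by exists w => //; apply: gt_trans sv vw.
by exists v.
Qed.

Lemma above_ind (P : term -> Prop) :
  (forall s, (forall t, above s t -> P t) -> P s) -> forall s, P s.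
Proof.
(* Generalised to all [l] encompassed by [s]: a [gt]-step from [l] lifts to one from [s], while a
   proper encompassment step keeps [s] fixed. *)
move=> H; suff K s : forall l, encompasses s l -> P l.
  by move=> s; apply: (K s); exact: encompasses_refl.
elim/(well_founded_ind (gt_wf gt_red)): s => s IHs.
elim/properly_encompasses_ind => l IHl sl; apply: H => m [[t lt tm]|lm].
  case: sl => C [sigma e]; apply: (IHs (fill C (subst sigma t))).
    by rewrite e; apply: gt_ctx => //; apply: gt_subst.
  by apply: encompasses_trans tm; exists C, sigma.
have [lm' _] := lm; apply: (IHl _ lm); exact: encompasses_trans sl lm'.
Qed.

Definition downward (D : term -> Prop) := forall s t, D s -> gt s t -> D t.

Definition below s t x : Prop := (s = x \/ gt s x) \/ (t = x \/ gt t x).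

Lemma below_sub (D : term -> Prop) s t : downward D -> D s -> D t ->
  forall x, below s t x -> D x.
Proof.
by move=> dD sD tD x [[<-//|/(dD _ _ sD)]|[<-//|/(dD _ _ tD)]].
Qed.

Lemma below_downward s t : downward (below s t).
Proof.
by move=> x y [[->|h]|[->|h]] h'; [left|left|right|right]; right => //;
   apply: gt_trans h h'.
Qed.

Definition connected X s t := conv_in (below s t) X s t.

Lemma connected_sym X s t : connected X s t -> connected X t s.
Proof.
by move=> /conv_in_sym; apply: conv_in_mono => x [h|h]; [right|left].
Qed.

Lemma connected_pair X s t : X (s, t) -> connected X s t.
Proof.
move=> h; apply: rt_step; split; [by left; left|by right; left|].
by left; apply: rstep_pair.
Qed.

(** Turns the bound by the two sides into any downward closed bound that holds for their instances,
    so that connected pairs can be used inside longer conversions. *)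
Lemma connected_conv_in (D : term -> Prop) X C sigma s t :
  downward D -> D (fill C (subst sigma s)) -> D (fill C (subst sigma t)) ->
  connected X s t -> conv_in D X (fill C (subst sigma s)) (fill C (subst sigma t)).
Proof.
move=> dD sD tD; apply: (conv_in_map (f := fun x => fill C (subst sigma x))).
  move=> x h; apply: (below_sub dD sD tD).
  by case: h => [[->|h]|[->|h]]; [left|left|right|right]; [left|right|left|right] => //;
     apply: gt_ctx => //; apply: gt_subst.
by move=> x y _ _ h; left; apply/srstep_fill/srstep_subst.
Qed.

(** * Effect and soundness of single inferences *)

Lemma kbo_rules_gt (P P' : es F V * es F V) : kbo gt P P' ->
  (forall l r, P.2 (l, r) -> gt l r) -> forall l r, P'.2 (l, r) -> gt l r.
Proof.
case=> [E R s t u _ _|E R s t _ st|E R s t _ st|E R s _|E R s t u _ tu|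
        E R s t u _ _|E R s t u _ _|E R s t u _ _] //= H l r.
- by case=> [/H//|[-> ->]].
- by case=> [/H//|[-> ->]].
- case=> [Rlr|[-> ->]]; first by apply: H; left.
  have st : gt s t by apply: H; right.
  apply: gt_trans st _ => //; apply: rstep_gt tu => l' r' [/ordered_rules_gt//|h].
  by apply: H; left.
- by move=> Rlr; apply: H; left.
Qed.

Definition simplified (E R : es F V) s u :=
  rstep R s u \/ ordered_step_enc gt E s u.

Lemma ordered_step_enc_mono (X Y : es F V) s t :
  X `<=` Y -> ordered_step_enc gt X s t -> ordered_step_enc gt Y s t.
Proof.
move=> XY [C [sigma [l [r [h1 h2]]]]]; exists C, sigma, l, r; split=> //.
by case: h1 => /XY; [left|right].
Qed.

Lemma ordered_rules_mono (X Y : es F V) : X `<=` Y ->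
  ordered_rules gt X `<=` ordered_rules gt Y.
Proof.
move=> XY e [l [r [sigma [h1 h2 h3]]]]; exists l, r, sigma; split=> //.
by case: h1 => /XY; [left|right].
Qed.

(** The cases are delete, orient and the two forms of simplify. *)
Lemma kbo_equation_removed (P P' : es F V * es F V) s t :
  kbo gt P P' -> P.1 (s, t) -> ~ P'.1 (s, t) ->
  [\/ s = t, P'.2 (s, t) \/ P'.2 (t, s),
      exists u, P'.1 (u, t) /\ simplified P.1 P.2 s u |
      exists u, P'.1 (s, u) /\ simplified P.1 P.2 t u].
Proof.
have mono (E : es F V) e R s0 u : rstep R s0 u \/ ordered_step_enc gt E s0 u ->
    simplified (E `|` [set e]) R s0 u.
  by case=> h; [left|right; apply: ordered_step_enc_mono h => x; left].
case=> [E R s0 t0 u _ _|E R s0 t0 _ st|E R s0 t0 _ st|E R s0 _|E R s0 t0 u _ tu|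
        E R s0 t0 u _ st|E R s0 t0 u _ st|E R s0 t0 u _ _] //= H nH.
- by case: nH; left.
- by case: H => [//|[-> ->]]; apply: Or42; left; right.
- by case: H => [//|[-> ->]]; apply: Or42; right; right.
- by case: H => [//|[-> ->]]; apply: Or41.
- case: H => [h|[e1 e2]]; first by case: nH; left.
  by subst; apply: Or43; exists u; split; [right|apply: mono].
- case: H => [h|[e1 e2]]; first by case: nH; left.
  by subst; apply: Or44; exists u; split; [right|apply: mono].
- by case: nH; left.
Qed.

(** The cases are compose and collapse. Properness is kept for collapse, because it makes the
    applied rule or equation smaller than the collapsed rule. *)
Lemma kbo_rule_removed (P P' : es F V * es F V) s t :
  kbo gt P P' -> P.2 (s, t) -> ~ P'.2 (s, t) ->
  (exists u, P'.2 (s, u) /\ rstep (ordered_rules gt P.1 `|` P.2) t u) \/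
  (exists u, P'.1 (u, t) /\ (rstep_enc P.2 s u \/ ordered_step_enc gt P.1 s u)).
Proof.
case=> [E R s0 t0 u _ _|E R s0 t0 _ st|E R s0 t0 _ st|E R s0 _|E R s0 t0 u _ tu|
        E R s0 t0 u _ st|E R s0 t0 u _ st|E R s0 t0 u _ tu] //= H nH.
- by case: nH; left.
- by case: nH; left.
- case: H => [h|[e1 e2]]; first by case: nH; left.
  subst; left; exists u; split; first by right.
  by apply: rstep_mono tu => e [h|h]; [left|right; left].
- case: H => [//|[e1 e2]]; subst; right; exists u; split; first by right.
  case: tu => [[C [sigma [l [r [h1 h2 h3 h4]]]]]|]; [left|by right].
  by exists C, sigma, l, r; split=> //; left.
Qed.

Lemma ordered_step_conv X s t : rstep (ordered_rules gt X) s t -> conv X s t.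
Proof.
move/rstep_orderedP => [C [sigma [l [r [/sym_pair h _ -> ->]]]]].
apply: conv_fill_subst; apply: rt_step.
by case: h => /rstep_pair; [left|right].
Qed.

Lemma ordered_step_enc_rstep X s t :
  ordered_step_enc gt X s t -> rstep (ordered_rules gt X) s t.
Proof.
by move=> [C [sigma [l [r [h [-> -> g _]]]]]]; apply/rstep_orderedP; exists C, sigma, l, r.
Qed.

Lemma rstep_enc_rstep X s t : rstep_enc X s t -> rstep X s t.
Proof. by move=> [C [sigma [l [r [h1 h2 h3 h4]]]]]; exists C, sigma, l, r. Qed.

Lemma rstep_conv X s t : rstep X s t -> conv X s t.
Proof. by move=> h; apply: rt_step; left. Qed.

Lemma conv_mono X Y s t : X `<=` Y -> conv X s t -> conv Y s t.
Proof.
move=> XY; apply: conv_of_pairs => l r /XY h.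
exact/rstep_conv/rstep_pair.
Qed.

Lemma kbo_sound (P P' : es F V * es F V) : kbo gt P P' ->
  forall s t, (P'.1 `|` P'.2) (s, t) -> conv (P.1 `|` P.2) s t.
Proof.
move=> K s t.
have in1 (X Y : es F V) l r : X (l, r) -> conv (X `|` Y) l r.
  by move=> h; apply/rstep_conv/rstep_pair; left.
have in2 (X Y : es F V) l r : Y (l, r) -> conv (X `|` Y) l r.
  by move=> h; apply/rstep_conv/rstep_pair; right.
have simp (X Y : es F V) x y : rstep Y x y \/ ordered_step_enc gt X x y -> conv (X `|` Y) x y.
  case=> [/rstep_conv|/ordered_step_enc_rstep/ordered_step_conv]; apply: conv_mono.
    by move=> ?; right.
  by move=> ?; left.
case: K => [E R s0 t0 u us ut|E R s0 t0 _ st|E R s0 t0 _ st|E R s0 _|E R s0 t0 u _ tu|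
        E R s0 t0 u _ st|E R s0 t0 u _ st|E R s0 t0 u _ tu] /=.
- have conv_peak x y : rstep (R `|` sym E) x y -> conv (E `|` R) x y.
    move=> /rstep_conv; apply: conv_of_pairs => l r [/in2//|/sym_pair[/in1//|h]].
    exact/conv_sym/in1.
  case=> [[/in1//|[-> ->]]|/in2//].
  exact: rt_trans (conv_sym (conv_peak _ _ us)) (conv_peak _ _ ut).
- case=> [h|[/in2//|[-> ->]]]; first by apply: in1; left.
  by apply: in1; right.
- case=> [h|[/in2//|[-> ->]]]; first by apply: in1; left.
  by apply/conv_sym/in1; right.
- case=> [h|/in2//]; by apply: in1; left.
- case=> [/in1//|[h|[-> ->]]]; first by apply: in2; left.
  apply: (@rt_trans _ _ _ t0); first by apply: in2; right.
  case: tu => C [sigma [l [r [h -> ->]]]]; apply: conv_fill_subst.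
  case: h => [h|h]; last by apply: in2; left.
  by apply: conv_mono (ordered_step_conv (rstep_pair h)) => x; left.
- case=> [[h|[-> ->]]|/in2//]; first by apply: in1; left.
  apply: (@rt_trans _ _ _ s0); last by apply: in1; right.
  apply/conv_sym; apply: conv_mono (simp _ _ _ _ st) => x [h|h]; last by right.
  by left; left.
- case=> [[h|[-> ->]]|/in2//]; first by apply: in1; left.
  apply: (@rt_trans _ _ _ t0); first by apply: in1; right.
  apply: conv_mono (simp _ _ _ _ st) => x [h|h]; last by right.
  by left; left.
- case=> [[/in1//|[-> ->]]|h]; last by apply: in2; left.
  apply: (@rt_trans _ _ _ t0); last by apply: in2; right.
  apply/conv_sym; have {}tu : rstep R t0 u \/ ordered_step_enc gt E t0 u.
    by case: tu => [/rstep_enc_rstep|]; [left|right].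
  apply: conv_mono (simp _ _ _ _ tu) => x [h|h]; first by left.
  by right; left.
Qed.

End Order.

(** * Every equation and rule of the run is connected in the limit *)

Section Run.
Variables (F : signature) (V : Type).
Local Notation term := (term F V).
Local Notation ctx := (ctx F V).
Implicit Types (s t u l r a b : term) (C : ctx) (sigma tau : V -> term).

Variable gt : relation term.
Hypothesis gt_red : reduction_order gt.
Variables E R : nat -> es F V.
Hypothesis run : kbo_run gt E R.
Hypothesis R0 : R 0%N = set0.

Local Notation W := (persistent E `|` persistent R).
Local Notation S := (S_omega gt E R).

Lemma run_rules_gt i l r : R i (l, r) -> gt l r.
Proof.
elim: i l r => [|i IH] l r; first by rewrite R0.
exact: (kbo_rules_gt gt_red (run i)).
Qed.

Lemma persistentP (X : nat -> es F V) e : persistent X e -> exists i, X i e.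
Proof. by move=> [i _ h]; exists i; apply: h => /=. Qed.

Lemma persistent_or_removed (X : nat -> es F V) i e :
  X i e -> persistent X e \/ exists j, X j e /\ ~ X j.+1 e.
Proof.
move=> Xi; have [|n] := pselect (exists j, X j e /\ ~ X j.+1 e); [by right|left].
exists i => // j /= /subnKC <-; elim: (j - i) => [|k IH]; first by rewrite addn0.
by apply: contrapT => nX; apply: n; exists (i + k); rewrite -addnS.
Qed.

Lemma run_sound i s t : (E i `|` R i) (s, t) -> conv (E 0) s t.
Proof.
elim: i s t => [|i IH] s t.
  by rewrite R0 => -[] // h; apply/rstep_conv/rstep_pair.
by move=> /(kbo_sound gt_red (run i)); apply: conv_of_pairs.
Qed.

Lemma simplified_gt i s t : simplified gt (E i) (R i) s t -> gt s t.
Proof.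
case=> [|/(ordered_step_enc_rstep gt_red)]; apply: (rstep_gt gt_red) => //.
  by move=> l r; apply: run_rules_gt.
by move=> l r; apply: ordered_rules_gt.
Qed.

(* A rule is measured by its left-hand side only and the bound is non-strict, since
   compose keeps the left-hand side; for an equation both sides must be strictly
   smaller, since orient can turn either of them into a left-hand side. *)
Definition good_upto a :=
  (forall l r i, encompasses a l -> R i (l, r) -> connected gt W l r) /\
  (forall u v i, above gt a u -> above gt a v -> E i (u, v) -> connected gt W u v).

Lemma connected_sym_pair i s t :
  (forall u v, (u = s /\ v = t) \/ (u = t /\ v = s) -> E i (u, v) -> connected gt W u v) ->
  sym (E i) (s, t) -> connected gt W s t.
Proof.
move=> H /sym_pair[h|h]; first by apply: H => //; left.
by apply/connected_sym/H => //; right.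
Qed.

Lemma connected_step (D : term -> Prop) C sigma l r :
  downward gt D -> D (fill C (subst sigma l)) ->
  gt (subst sigma l) (subst sigma r) -> connected gt W l r ->
  conv_in D W (fill C (subst sigma l)) (fill C (subst sigma r)).
Proof.
move=> dD Dl g; apply: (connected_conv_in gt_red) => //.
by apply: dD Dl _; apply: gt_ctx.
Qed.

Lemma rule_step_gt i sigma l r : R i (l, r) -> gt (subst sigma l) (subst sigma r).
Proof. by move/run_rules_gt; apply: gt_subst. Qed.

(** An applied rule has its left-hand side encompassed by [a], which the non-strict bound admits.
    For an applied equation, [l] is properly encompassed by [a], and [r] is encompassed by the
    smaller term [t]. *)
Lemma good_upto_simplified a i (D : term -> Prop) t :
  good_upto a -> downward gt D -> D a -> simplified gt (E i) (R i) a t ->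
  conv_in D W a t.
Proof.
move=> [QR QE] dD Da [[C [sigma [l [r [h e ->]]]]]|[C [sigma [l [r [h [e e' g p]]]]]]].
  have c : connected gt W l r by apply: QR h; rewrite e; exists C, sigma.
  rewrite e in Da *; exact: connected_step dD Da (rule_step_gt _ h) c.
have ar : above gt a r.
  by left; exists t; [rewrite e e'; apply: gt_ctx|rewrite e'; exists C, sigma].
have c : connected gt W l r.
  by apply: connected_sym_pair h => u v uv; apply: QE; case: uv => -[? ?]; subst u v => //; right.
by rewrite e' {1}e; apply: connected_step => //; rewrite -e.
Qed.

(** Nested induction on both sides, since simplify lowers one and keeps the other; an oriented
    equation is covered by [good_upto] of its left-hand side. The parameter [D] allows use inside
    the induction on [above] as well as for all terms afterwards. *)
Lemma equations_connected (D : term -> Prop) : downward gt D ->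
  (forall a, D a -> good_upto a) ->
  forall u v i, D u -> D v -> E i (u, v) -> connected gt W u v.
Proof.
move=> dD Q; elim/(well_founded_ind (gt_wf gt_red)) => u IHu.
elim/(well_founded_ind (gt_wf gt_red)) => v IHv i Du Dv h.
have [p|[j [hj nj]]] := persistent_or_removed h.
  by apply: connected_pair; left.
have dB := below_downward gt_red (s := u) (t := v).
have Bu : below gt u v u by left; left.
have Bv : below gt u v v by right; left.
have [->|[h'|h']|[w [h1 h2]]|[w [h1 h2]]] := kbo_equation_removed (run j) hj nj.
- exact: rt_refl.
- exact: (Q u Du).1 (encompasses_refl u) h'.
- exact/connected_sym/((Q v Dv).1 _ _ _ (encompasses_refl v) h').
- have g := simplified_gt h2.
  apply: rt_trans (good_upto_simplified (Q u Du) dB Bu h2) _.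
  have := IHu w g v _ (dD _ _ Du g) Dv h1.
  by apply: conv_in_mono; apply: (below_sub dB) => //; apply: dB Bu g.
- have g := simplified_gt h2.
  apply: rt_trans _ (conv_in_sym (good_upto_simplified (Q v Dv) dB Bv h2)).
  have := IHv w g _ Du (dD _ _ Dv g) h1.
  by apply: conv_in_mono; apply: (below_sub dB) => //; apply: dB Bv g.
Qed.

Lemma all_good_upto a : good_upto a.
Proof.
elim/(above_ind gt_red): a => a IH.
have eqs : forall u v i, above gt a u -> above gt a v -> E i (u, v) -> connected gt W u v.
  by apply: equations_connected => // s t; apply: above_gt.
(* Compose keeps [l] and lowers [r], hence an inner induction on [r]. *)
split=> // l r i al; elim/(well_founded_ind (gt_wf gt_red)): r i => r IHr i h.
have [p|[j [hj nj]]] := persistent_or_removed h.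
  by apply: connected_pair; right.
have g := run_rules_gt hj.
have dB := below_downward gt_red (s := l) (t := r).
have Bl : below gt l r l by left; left.
have Br : below gt l r r by right; left.
have ar : above gt a r by exact: (encompasses_above gt_red al (gt_above g)).
have [[u [h1 h2]]|[u [h1 h2]]] := kbo_rule_removed (run j) hj nj.
  (* Compose: what is applied is encompassed by [r] or [u], both strictly below [a]. *)
  have ru : gt r u.
    by apply: (rstep_gt gt_red) h2 => // l' r' [/ordered_rules_gt|/run_rules_gt].
  apply: rt_trans (_ : conv_in _ _ l u) _.
    have := IHr u ru _ h1; apply: conv_in_mono; apply: (below_sub dB) => //.
    exact: dB Br ru.
  apply/conv_in_sym; case/rstep_setU: h2; last first.
    move=> [C [sigma [l' [r' [h2 e ->]]]]]; have c : connected gt W l' r'.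
      by apply: (IH _ ar).1 h2; rewrite e; exists C, sigma.
    rewrite {2}e; apply: (connected_step dB) (rule_step_gt _ h2) c; by rewrite -e.
  move/(rstep_orderedP gt_red) => [C [sigma [l' [r' [h2 g' e e']]]]].
  rewrite e' {2}e; apply: (connected_step dB) => //; first by rewrite -e.
  have al' : above gt a l' by apply: above_encompasses ar _; rewrite e; exists C, sigma.
  have ar' : above gt a r'.
    by apply: above_encompasses (above_gt gt_red ar ru) _; rewrite e'; exists C, sigma.
  by apply: connected_sym_pair h2 => x y xy; apply: eqs; case: xy => -[? ?]; subst x y.
(* Collapse: both sides of the new equation are strictly below [a], and by properness so is the
   left-hand side of what is applied to [l]. *)
have h3 : simplified gt (E j) (R j) l u.
  by case: h2 => [/rstep_enc_rstep h'|h']; [left|right].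
have lu := simplified_gt h3.
have au : above gt a u by exact: (encompasses_above gt_red al (gt_above lu)).
apply: rt_trans (_ : conv_in _ _ l u) _; last first.
  have := eqs u r _ au ar h1; apply: conv_in_mono; apply: (below_sub dB) => //.
  exact: dB Bl lu.
case: h2 => [[C [sigma [l' [r' [h2 e e' p]]]]]|[C [sigma [l' [r' [h2 [e e' g' p]]]]]]].
  rewrite e' {2}e; apply: (connected_step dB) (rule_step_gt _ h2) _; first by rewrite -e.
  apply: (IH l' _).1 (encompasses_refl l') h2.
  by apply: (encompasses_above gt_red al) _; right.
rewrite e' {2}e; apply: (connected_step dB) => //; first by rewrite -e.
have al' : above gt a l' by apply: (encompasses_above gt_red al) _; right.
have ar' : above gt a r' by apply: above_encompasses au _; rewrite e'; exists C, sigma.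
by apply: connected_sym_pair h2 => x y xy; apply: eqs; case: xy => -[? ?]; subst x y.
Qed.

Lemma run_connected s t i : (E i `|` R i) (s, t) -> connected gt W s t.
Proof.
case=> h; last exact: (all_good_upto s).1 (encompasses_refl s) h.
apply: (@equations_connected (fun=> True)) h => // a _; exact: all_good_upto.
Qed.

End Run.

(** * Ground confluence *)

Section GroundConfluence.
Variables (F : signature) (V : Type).
Local Notation term := (term F V).
Local Notation ctx := (ctx F V).
Implicit Types (s t u l r a b c d : term) (C D : ctx) (sigma tau : V -> term).

Hypothesis V_infinite : infinite_set [set: V].
Variable gt : relation term.
Hypothesis gt_red : reduction_order gt.
Hypothesis gt_total : ground_total gt.
Variables E R : nat -> es F V.
Hypothesis run : kbo_run gt E R.
Hypothesis R0 : R 0%N = set0.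
Hypothesis run_fair : fair gt E R.

Local Notation W := (persistent E `|` persistent R).
Local Notation S := (S_omega gt E R).

Lemma persistent_rules_gt l r : persistent R (l, r) -> gt l r.
Proof. by move=> /persistentP[i /(run_rules_gt gt_red run R0)]. Qed.

Lemma S_gt l r : S (l, r) -> gt l r.
Proof. by case=> [/ordered_rules_gt|/persistent_rules_gt]. Qed.

Lemma S_rsteps_gt s t : rsteps S s t -> s = t \/ gt s t.
Proof. by apply: (rsteps_gt gt_red) => l r; apply: S_gt. Qed.

(** Treating persistent rules as equations adds no steps, since their reversed instances are never
    decreasing. *)
Lemma S_rstepE s t : rstep S s t <-> rstep (ordered_rules gt W) s t.
Proof.
split.
  apply: rstep_mono => -[l r] [h|h]; first by apply: ordered_rules_mono h => x; left.
  by exists l, r, Var; rewrite !subst_Var; split=> //; [left; right|apply: persistent_rules_gt].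
move/(rstep_orderedP gt_red) => [C [sigma [l [r [lr g -> ->]]]]].
apply: rstep_fill; case/sym_pair: lr => -[] h.
- by apply: rstep_pair; left; exists l, r, sigma; split=> //; left.
- by apply: rstep_subst; apply: rstep_pair; right.
- by apply: rstep_pair; left; exists l, r, sigma; split=> //; right.
- case: (gt_irrefl gt_red (s := subst sigma l)); apply: (gt_trans gt_red) g _.
  by apply: gt_subst => //; apply: persistent_rules_gt.
Qed.

(** Ground totality enters here: the two sides of the applied instance are ground, hence equal or
    comparable. *)
Lemma ground_srstep s t : ground s -> ground t -> srstep W s t ->
  srstep S s t \/ s = t.
Proof.
have K x y : ground x -> ground y -> rstep W x y -> srstep S x y \/ x = y.
  move=> gx gy [C [sigma [l [r [lr ex ey]]]]]; rewrite ex ey in gx gy *.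
  have [->|ne] := pselect (subst sigma l = subst sigma r); first by right.
  left; case: (gt_total (ground_fill gx) (ground_fill gy) ne) => g; [left|right].
    by apply/S_rstepE/(rstep_orderedP gt_red); exists C, sigma, l, r; split=> //; left.
  by apply/S_rstepE/(rstep_orderedP gt_red); exists C, sigma, r, l; split=> //; right.
move=> gs gt_ [h|h]; first exact: K.
by case: (K _ _ gt_ gs h) => [/srstep_sym|]; [left|right].
Qed.

(* Ground terms smaller than [s] only, so that the induction hypothesis of
   Newman's lemma turns such a conversion into joinability. *)
Definition conv_below s := conv_in (fun x => ground x /\ gt s x) S.

Lemma conv_below_trans s t u v :
  conv_below s t u -> conv_below s u v -> conv_below s t v.
Proof. exact: rt_trans. Qed.

(** Intermediate terms may contain variables. Substituting the ground term [s] for all of them fixes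
    the end points and keeps every term below [s]. *)
Lemma conv_below_of_conv_in s t u : ground s -> gt s t -> gt s u ->
  conv_in (gt s) W t u -> conv_below s t u.
Proof.
move=> gs st su h; set f := subst (fun=> s).
have fid x : ground x -> f x = x by apply: ground_subst_id.
rewrite -(fid t (gt_ground gt_red st gs)) -(fid u (gt_ground gt_red su gs)).
apply: conv_in_map h => [x sx|x y [gx _] [gy _] /(srstep_subst (fun=> s))].
  split; first exact: ground_substP.
  by rewrite -[s]fid //; apply: gt_subst.
exact: ground_srstep.
Qed.

Lemma conv_below_rsteps s t u : ground s -> gt s t -> rsteps S t u ->
  conv_below s t u.
Proof.
move=> gs + tu; elim: tu => [x y h|x|x y z xy IH1 yz IH2] sx.
- have sy : gt s y by apply: (gt_trans gt_red) sx (rstep_gt gt_red S_gt h).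
  have gx := gt_ground gt_red sx gs; have gy := gt_ground gt_red sy gs.
  by apply: rt_step; split; [split|split|left].
- exact: rt_refl.
- have sy : gt s y.
    by case: (S_rsteps_gt xy) => [<-//|]; apply: (gt_trans gt_red) sx.
  exact: rt_trans (IH1 sx) (IH2 sy).
Qed.

Lemma conv_below_joinable s t u : ground s -> gt s t -> gt s u ->
  joinable S t u -> conv_below s t u.
Proof.
move=> gs st su [v [tv uv]]; apply: conv_below_trans (conv_below_rsteps gs st tv) _.
exact/conv_in_sym/conv_below_rsteps.
Qed.

(** Root steps of [S_omega] as decreasing instances of pairs in [W], the form in which overlaps are
    stated. *)
Definition redex a b := exists l r sigma,
  [/\ sym W (l, r), gt (subst sigma l) (subst sigma r),
      a = subst sigma l & b = subst sigma r].

Lemma redex_gt a b : redex a b -> gt a b.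
Proof. by move=> [l [r [sigma [_ g -> ->]]]]. Qed.

Lemma rstep_redexP s t : rstep S s t <->
  exists C a b, [/\ redex a b, s = fill C a & t = fill C b].
Proof.
rewrite S_rstepE (rstep_orderedP gt_red); split.
  move=> [C [sigma [l [r [h g -> ->]]]]].
  by exists C, (subst sigma l), (subst sigma r); split=> //; exists l, r, sigma.
move=> [C [_ [_ [[l [r [sigma [h g -> ->]]]] -> ->]]]].
by exists C, sigma, l, r.
Qed.

Lemma redex_rstep C a b : redex a b -> rstep S (fill C a) (fill C b).
Proof. by move=> h; apply/rstep_redexP; exists C, a, b. Qed.

Lemma fill_redex_gt C a b : redex a b -> gt (fill C a) (fill C b).
Proof. by move=> /redex_gt; apply: gt_ctx. Qed.

Definition prime_redex a :=
  forall v, proper_subterm v a -> normal_form (ordered_rules gt W) v.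

Lemma innermost_redex v : ~ normal_form (ordered_rules gt W) v ->
  exists C a b, [/\ v = fill C a, redex a b & prime_redex a].
Proof.
have [n] := ubnP (tsize v); elim: n v => [//|n IH] v; rewrite ltnS => vn.
move=> /contrapT[u /S_rstepE/rstep_redexP[C [a [b [ab e _]]]]].
have [p|/existsNP[w /not_implyP[wa nw]]] := pselect (prime_redex a).
  by exists C, a, b.
have [|D [a' [b' [e' ab' p]]]] := IH w _ nw.
  apply: leq_trans (tsize_proper wa) _; apply: leq_trans vn; rewrite e.
  by have [] := tsize_fill C a.
case: wa => D' _ e2; exists (comp_ctx C (comp_ctx D' D)), a', b'; split=> //.
by rewrite !fill_comp e e2 e'.
Qed.

(** Joining sequences descend and thus stay below [s]; a step with an equation of the run is
    replaced by a bounded conversion through [run_connected]. *)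
Lemma conv_below_PCP s C delta t u : ground s ->
  gt s (fill C (subst delta t)) -> gt s (fill C (subst delta u)) ->
  PCP gt W (t, u) ->
  conv_below s (fill C (subst delta t)) (fill C (subst delta u)).
Proof.
move=> gs st su /run_fair[[v [tv uv]]|h].
  apply: conv_below_joinable => //; exists (fill C (subst delta v)).
  by split; apply: rsteps_fill; apply: rsteps_subst.
have dD : downward gt (gt s) by move=> x y; exact: (gt_trans gt_red).
apply: (conv_below_of_conv_in gs st su); apply: (connected_conv_in gt_red dD st su).
suff K x y : rstep (union_of E) x y -> connected gt W x y.
  by case: h => /K // /connected_sym.
move=> [D [sigma [l [r [[i _ lr] -> ->]]]]].
apply: (connected_conv_in gt_red (D := below gt _ _)); first exact: below_downward.
- by left; left.
- by right; left.
by apply: (run_connected gt_red run R0 (i := i)); left.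
Qed.

Lemma redex_common_subst l1 r1 sigma1 l2 r2 sigma2 :
  exists pi sigma, let rho := subst (fun x => Var (pi x)) in
    [/\ renaming pi,
        (vars (rho l1) `|` vars (rho r1)) `&` (vars l2 `|` vars r2) = set0,
        subst sigma (rho l1) = subst sigma1 l1 /\ subst sigma (rho r1) = subst sigma1 r1 &
        subst sigma l2 = subst sigma2 l2 /\ subst sigma r2 = subst sigma2 r2].
Proof.
pose B := varseq l2 ++ varseq r2.
have [pi bpi fresh] := fresh_renaming V_infinite (varseq l1 ++ varseq r1) B.
have freshP x : (vars l1 `|` vars r1) x -> pi x \notin B.
  by move=> h; apply: fresh; rewrite mem_cat; case: h => /varseqP ->; rewrite ?orbT.
have inB x : (vars l2 `|` vars r2) x -> (x : {classic V}) \in B.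
  by rewrite mem_cat => -[] /varseqP ->; rewrite ?orbT.
have [pi' piK _] := bpi.
(* On the variables of the second pair use [sigma2]; elsewhere undo the renaming and use
   [sigma1]. *)
exists pi, (fun z => if (z : {classic V}) \in B then sigma2 z else sigma1 (pi' z)).
split=> //.
- rewrite -subset0 => z [zl /inB]; apply/negP.
  have [x xl ->] : exists2 x, (vars l1 `|` vars r1) x & z = pi x.
    by case: zl => /vars_subst[x xl /= ->]; exists x => //; [left|right].
  exact: freshP.
- by split; rewrite subst_comp; apply: eq_in_subst => x xl /=;
    rewrite ifN ?piK //; apply: freshP; [left|right].
- by split; apply: eq_in_subst => x xl; rewrite inB //; [left|right].
Qed.

Lemma prime_nested_peak D C a b c d :
  redex a b -> redex c d -> c = fill C a -> prime_redex a ->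
  ground (fill D c) ->
  conv_below (fill D c) (fill D (fill C b)) (fill D d).
Proof.
move=> ab cd ec pa gs.
have st : gt (fill D c) (fill D (fill C b)).
  by rewrite ec -!fill_comp; apply: fill_redex_gt.
have su : gt (fill D c) (fill D d) by apply: fill_redex_gt.
case: (ab) => l1 [r1 [sigma1 [lr1 g1 ea eb]]].
case: (cd) => l2 [r2 [sigma2 [lr2 g2 ec2 ed]]].
have [pi [sigma [bpi dis [e1 e2] [e3 e4]]]] :=
  redex_common_subst l1 r1 sigma1 l2 r2 sigma2.
set rho := subst (fun x => Var (pi x)) in dis e1 e2.
rewrite -e3 -e4 in g2 ec2 ed; rewrite -e1 -e2 in g1 ea eb.
have eC : fill C a = subst sigma l2 by rewrite -ec.
have [[q [v [h1 h2 h3 h4]]]|[x [C' [h1 h2]]]] := overlap_cases eC; last first.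
  (* variable overlap: both reducts rewrite to instances of the outer pair under [sigma'] *)
  set sigma' := update sigma x (fill C' b).
  have ab1 : rsteps S a b by apply: rt_step; apply: (redex_rstep Hole).
  have hl : rsteps S (fill D (fill C b)) (fill D (subst sigma' l2)).
    exact/rsteps_fill/h2.
  have hr : rsteps S (fill D d) (fill D (subst sigma' r2)).
    apply: rsteps_fill; rewrite ed; apply: rsteps_subst_fun => y.
    have [->|yx] := pselect (y = x); last by rewrite /sigma' update_neq //; exact: rt_refl.
    by rewrite /sigma' update_eq h1; exact: rsteps_fill.
  have gl : gt (fill D c) (fill D (subst sigma' l2)).
    by case: (S_rsteps_gt hl) => [<-//|]; apply: (gt_trans gt_red) st.
  have gr : gt (fill D c) (fill D (subst sigma' r2)).
    by case: (S_rsteps_gt hr) => [<-//|]; apply: (gt_trans gt_red) su.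
  apply: conv_below_trans (conv_below_rsteps gs st hl) _.
  apply: conv_below_trans _ (conv_in_sym (conv_below_rsteps gs su hr)).
  (* The instances under [sigma'] need not be ordered as those under [sigma], so they are linked by
     an unoriented step of [W]. *)
  apply: conv_below_of_conv_in => //; apply: rt_step; split=> //.
  apply/srstep_fill/srstep_subst.
  by case/sym_pair: lr2 => /rstep_pair; [left|right].
(* Proper overlap: the peak is an instance, by [delta], of an extended critical pair. *)
have [mu muP] : exists mu, is_mgu mu (rho l1) v.
  by apply: (mgu_exists (tau := sigma)); rewrite -ea -h3.
have [delta dE] : exists delta, forall x, sigma x = subst delta (mu x).
  by apply: muP.2; rewrite -ea -h3.
have sE t : subst sigma t = subst delta (subst mu t).
  by rewrite subst_comp; apply: eq_in_subst => x _.
have not_gt l r : gt (subst sigma l) (subst sigma r) -> ~ gt (subst mu r) (subst mu l).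
  move=> g /(gt_subst gt_red delta); rewrite -!sE => g'.
  exact: (gt_irrefl gt_red) (gt_trans gt_red g g').
have et : fill C b = subst delta (subst mu (replace_at l2 q (rho r1))).
  by rewrite -sE h4 -eb.
rewrite et ed sE; apply: conv_below_PCP => //.
- by rewrite -et.
- by rewrite -sE -ed.
exists (rho l1, rho r1), q, (l2, r2), mu; split=> //.
  split; first by exists (l1, r1) => //; exists pi.
  split; first by exists (l2, r2) => //; exists id; [exists id|rewrite /= !subst_Var].
  split=> //; split; first by exists v.
  by split; apply: not_gt.
(* Primality: a step from a proper subterm of the [mu]-instance would, under [delta], give one from
   a proper subterm of [a]. *)
move=> w /(proper_subterm_subst delta); rewrite -sE -ea => /pa nf [u wu].
by apply: nf; exists (subst delta u); apply: rstep_subst.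
Qed.

(* If some proper subterm of [a] is reducible, an innermost redex [a'] inside it
   gives a third reduct of the common source that connects the other two. *)
Lemma nested_peak D C a b c d :
  redex a b -> redex c d -> c = fill C a -> ground (fill D c) ->
  conv_below (fill D c) (fill D (fill C b)) (fill D d).
Proof.
move=> ab cd ec gs; have [p|] := pselect (prime_redex a).
  exact: prime_nested_peak cd ec p gs.
move=> /existsNP[v /not_implyP[[C1 _ ea] nv]].
have [C2 [a' [b' [ev ab' p]]]] := innermost_redex nv.
have ea' : a = fill (comp_ctx C1 C2) a' by rewrite fill_comp -ev.
have gs' : ground (fill (comp_ctx D C) a) by rewrite fill_comp -ec.
have := prime_nested_peak ab' ab ea' p gs'.
have ec' : c = fill (comp_ctx C (comp_ctx C1 C2)) a' by rewrite fill_comp -ea'.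
have := prime_nested_peak ab' cd ec' p gs.
rewrite !fill_comp -ec => h1 h2; exact: conv_below_trans (conv_in_sym h2) h1.
Qed.

Lemma ground_peak s t u : ground s -> rstep S s t -> rstep S s u ->
  conv_below s t u.
Proof.
move=> gs st su.
move/rstep_redexP: (st) => [C1 [a [b [ab e1 et]]]].
move/rstep_redexP: (su) => [C2 [c [d [cd e2 eu]]]].
have [] := fill_eq_cases (etrans (esym e1) e2).
- move=> [C [ec h]]; rewrite et eu h e2; apply: nested_peak ab cd ec _.
  by rewrite -e2.
- move=> [C [ea h]]; rewrite et eu h e1; apply: conv_in_sym.
  by apply: nested_peak cd ab ea _; rewrite -e1.
move=> /(_ b d)[D1 [D2 [h1 h2 h3]]].
apply: conv_below_joinable => //; [exact: rstep_gt S_gt st|exact: rstep_gt S_gt su|].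
exists (fill D2 d); split; apply: rt_step; last first.
  by rewrite h3 eu h2; apply: redex_rstep.
by rewrite et h1; apply: redex_rstep.
Qed.

Lemma ground_confluent s : ground s ->
  forall t u, rsteps S s t -> rsteps S s u -> joinable S t u.
Proof.
elim/(well_founded_ind (gt_wf gt_red)): s => s IH gs.
(* Induction along the conversion; a reversed first step is absorbed by confluence at its smaller
   source [y]. *)
have cb t u : conv_below s t u -> joinable S t u.
  move=> /clos_rt_rt1n_iff; elim=> [x|x y z [_ [gy sy] xy] _ [w [yw zw]]].
    by exists x; split; exact: rt_refl.
  case: xy => [xy|yx].
    by exists w; split=> //; apply: rt_trans yw; apply: rt_step.
  have [w' [xw' ww']] := IH y sy gy x w (rt_step _ _ _ _ yx) yw.
  by exists w'; split=> //; apply: rt_trans zw ww'.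
move=> t u /clos_rt_rt1n_iff; case=> [|t1 {}t st1 /clos_rt_rt1n_iff t1t].
  by move=> su; exists u; split=> //; exact: rt_refl.
move=> /clos_rt_rt1n_iff; case=> [|u1 {}u su1 /clos_rt_rt1n_iff u1u].
  exists t; split; first exact: rt_refl.
  by apply: rt_trans t1t; apply: rt_step.
have g1 := rstep_gt gt_red S_gt st1; have g2 := rstep_gt gt_red S_gt su1.
have [v [t1v u1v]] := cb _ _ (ground_peak gs st1 su1).
have [w [tw vw]] := IH t1 g1 (gt_ground gt_red g1 gs) t v t1t t1v.
have [w' [ww' uw']] := IH u1 g2 (gt_ground gt_red g2 gs) w u (rt_trans _ _ _ _ _ u1v vw) u1u.
by exists w'; split=> //; apply: rt_trans tw ww'.
Qed.

End GroundConfluence.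

Unset Implicit Arguments.

Theorem theorem7p16 (F : signature) (V : Type)
    (V_infinite : infinite_set [set: V])
    (gt : relation (term F V)) (E R : nat -> es F V)
    (gt_red : reduction_order gt) (gt_total : ground_total gt)
    (run : kbo_run gt E R) (R0 : R 0%N = set0)
    (run_fair : fair gt E R) :
  ground_complete (S_omega gt E R) /\
  (forall s t : term F V,
     conv (E 0%N) s t <-> conv (persistent E `|` persistent R) s t).
Proof.
have Sgt l r := @S_gt F V gt gt_red E R run R0 l r.
split.
  split.
  - by move=> l r /Sgt g; split; [exact: gt_not_var gt_red _ _ g|exact: gt_vars gt_red _ _ g].
  - elim/(well_founded_ind (gt_wf gt_red)) => s IH; constructor=> t st.
    exact: IH (rstep_gt gt_red Sgt st).
  (* The source of the peak may contain variables that rewriting erases; instantiating them by [s]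
     leaves the ground terms [s] and [t] unchanged. *)
  - move=> s t gs gt_ [u [us ut]]; have gu : ground (subst (fun=> s) u) by apply: ground_substP.
    apply: (ground_confluent V_infinite gt_red gt_total run R0 run_fair gu).
      by have := rsteps_subst (fun=> s) us; rewrite (ground_subst_id _ gs).
    by have := rsteps_subst (fun=> s) ut; rewrite (ground_subst_id _ gt_).
move=> s t; split; apply: conv_of_pairs => l r h.
  apply: conv_in_conv; apply: (run_connected gt_red run R0 (i := 0)); by left.
by case: h => /persistentP[i h]; apply: (run_sound gt_red run R0 (i := i)); [left|right].
Qed.
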